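(* Let $n,m$ be integers such that $n\ge 5$, $m\ge 2$ and $n\ge m$. Let $\psi\colon VSG_n\to S_m$ be a group homomorphism. Then, up to conjugation, one of the following possibilities holds: (1) $\psi$ is abelian; (2) $n=m$ and $\psi\in\{\phi_{(1,1,1)},\phi_{(1,0,1)},\phi_{(0,0,1)}\}$; (3) $n=m=6$ and $\psi\in\{\nu_6\circ\phi_{(1,1,1)},\ \nu_6\circ\phi_{(1,0,1)},\ \nu_6\circ\phi_{(0,0,1)}\}$.
   Context: For $n\ge 2$, $VSG_n$ is the group with generators $\sigma_1,\dots,\sigma_{n-1},\tau_1,\dots,\tau_{n-1},v_1,\dots,v_{n-1}$ and relations (for all admissible indices): $\sigma_i\sigma_j=\sigma_j\sigma_i$, $v_iv_j=v_jv_i$, $\tau_i\tau_j=\tau_j\tau_i$, $\sigma_i\tau_j=\tau_j\sigma_i$, $\sigma_iv_j=v_j\sigma_i$, $\tau_iv_j=v_j\tau_i$ whenever $|i-j|\ge 2$; $v_i^2=1$ and $\sigma_i\tau_i=\tau_i\sigma_i$ for $1\le i\le n-1$; and for $1\le i\le n-2$: $\sigma_i\sigma_{i+1}\sigma_i=\sigma_{i+1}\sigma_i\sigma_{i+1}$, $v_iv_{i+1}v_i=v_{i+1}v_iv_{i+1}$, $\sigma_i\sigma_{i+1}\tau_i=\tau_{i+1}\sigma_i\sigma_{i+1}$, $\sigma_{i+1}\sigma_i\tau_{i+1}=\tau_i\sigma_{i+1}\sigma_i$, $v_i\sigma_{i+1}v_i=v_{i+1}\sigma_iv_{i+1}$,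 $v_i\tau_{i+1}v_i=v_{i+1}\tau_iv_{i+1}$. For $(\epsilon_1,\epsilon_2,\epsilon_3)\in\{(1,1,1),(1,0,1),(0,0,1)\}$, $\phi_{(\epsilon_1,\epsilon_2,\epsilon_3)}\colon VSG_n\to S_n$ is the homomorphism given by $\sigma_i\mapsto(i\ i+1)^{\epsilon_1}$, $\tau_i\mapsto(i\ i+1)^{\epsilon_2}$, $v_i\mapsto(i\ i+1)^{\epsilon_3}$ for $1\le i\le n-1$. $\nu_6$ denotes the exceptional outer automorphism of $S_6$ (unique up to inner automorphisms). Two homomorphisms $\psi_1,\psi_2\colon G\to H$ are conjugate if there is $h\in H$ with $\psi_2(g)=h\psi_1(g)h^{-1}$ for all $g\in G$; a homomorphism is abelian if its image is an abelian group. *)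

(* Defs.v *)
From HB Require Import structures.
From mathcomp Require Import all_boot all_fingroup.
From mathcomp Require Import boolp generic_quotient zify.

Set Implicit Arguments.
Unset Strict Implicit.
Unset Printing Implicit Defensive.

Local Open Scope group_scope.
Local Open Scope quotient_scope.

(* A letter (x, false) stands for the generator x, and (x, true) for x^-1. *)
Definition word (X : Type) := seq (X * bool).

Definition winv (X : Type) (w : word X) : word X :=
  rev [seq (l.1, ~~ l.2) | l <- w].

(* Equality of words in the group < X | u = v for R u v >. *)
Inductive pres_eq (X : Type) (R : word X -> word X -> Prop) :
    word X -> word X -> Prop :=
| pres_eq_refl w : pres_eq R w w
| pres_eq_sym u v : pres_eq R u v -> pres_eq R v u
| pres_eq_trans u v w : pres_eq R u v -> pres_eq R v w -> pres_eq R u w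
| pres_eq_cat u u' v v' :
    pres_eq R u u' -> pres_eq R v v' -> pres_eq R (u ++ v) (u' ++ v')
| pres_eq_cancel x b : pres_eq R [:: (x, b); (x, ~~ b)] [::]
| pres_eq_rel u v : R u v -> pres_eq R u v.

Section PresentedGroup.
Variables (X : choiceType) (R : word X -> word X -> Prop).

Definition pres_eqb : rel (word X) := fun u v => `[< pres_eq R u v >].

Lemma pres_eqb_refl : reflexive pres_eqb.
Proof. by move=> w; apply/asboolP; apply: pres_eq_refl. Qed.

Lemma pres_eqb_sym : symmetric pres_eqb.
Proof. by move=> u v; apply/asboolP/asboolP => /pres_eq_sym. Qed.

Lemma pres_eqb_trans : transitive pres_eqb.
Proof.
move=> v u w /asboolP uv /asboolP vw.
by apply/asboolP; apply: pres_eq_trans uv vw.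
Qed.

Canonical pres_equiv :=
  EquivRel pres_eqb pres_eqb_refl pres_eqb_sym pres_eqb_trans.

Definition presented := {eq_quot pres_equiv}.

HB.instance Definition _ := Choice.copy presented {eq_quot pres_equiv}.

Definition pres_class (w : word X) : presented := \pi_presented w.

Lemma pres_classP u v : pres_class u = pres_class v <-> pres_eq R u v.
Proof.
by split=> [/eqmodP/asboolP//|uv]; apply/eqmodP; apply/asboolP.
Qed.

Lemma pres_classK (g : presented) : pres_class (repr g) = g.
Proof. exact: reprK. Qed.

Lemma pres_repr_class w : pres_eq R (repr (pres_class w)) w.
Proof. by apply/pres_classP; rewrite pres_classK. Qed.

Lemma winvK : involutive (@winv X).
Proof.
move=> w; rewrite /winv map_rev revK -map_comp map_id_in // => -[x b] _ /=.
by rewrite negbK.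
Qed.

Lemma pres_eq_mulwV w : pres_eq R (w ++ winv w) [::].
Proof.
elim: w => [|[x b] w IHw]; first exact: pres_eq_refl.
rewrite /winv /= rev_cons -rcons_cat -cats1 -cat1s.
apply: (@pres_eq_trans _ _ _ ([:: (x, b)] ++ [::] ++ [:: (x, ~~ b)])).
  by do 2?[apply: pres_eq_cat]; try exact: pres_eq_refl; exact: IHw.
exact: pres_eq_cancel.
Qed.

Lemma pres_eq_mulVw w : pres_eq R (winv w ++ w) [::].
Proof. by rewrite -{2}[w]winvK; apply: pres_eq_mulwV. Qed.

Lemma pres_eq_inv u v : pres_eq R u v -> pres_eq R (winv u) (winv v).
Proof.
move=> uv; apply: (@pres_eq_trans _ _ _ (winv u ++ (v ++ winv v))).
  rewrite -{1}[winv u]cats0; apply: pres_eq_cat; first exact: pres_eq_refl.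
  exact/pres_eq_sym/pres_eq_mulwV.
rewrite catA -{2}[winv v]cat0s; apply: pres_eq_cat; last exact: pres_eq_refl.
apply: (@pres_eq_trans _ _ _ (winv u ++ u)); last exact: pres_eq_mulVw.
by apply: pres_eq_cat; [exact: pres_eq_refl | exact: pres_eq_sym].
Qed.

Definition pres_one : presented := pres_class [::].
Definition pres_inv (g : presented) : presented := pres_class (winv (repr g)).
Definition pres_mul (g h : presented) : presented :=
  pres_class (repr g ++ repr h).

Lemma pres_class_cat u v :
  pres_mul (pres_class u) (pres_class v) = pres_class (u ++ v).
Proof. by apply/pres_classP; apply: pres_eq_cat; apply: pres_repr_class. Qed.

Lemma pres_class_inv w : pres_inv (pres_class w) = pres_class (winv w).
Proof. by apply/pres_classP; apply: pres_eq_inv; apply: pres_repr_class. Qed.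

Lemma pres_mulA : associative pres_mul.
Proof.
move=> a b c; rewrite -[a]pres_classK -[b]pres_classK -[c]pres_classK.
by rewrite !pres_class_cat catA.
Qed.

Lemma pres_mul1g : left_id pres_one pres_mul.
Proof. by move=> a; rewrite -[a]pres_classK pres_class_cat. Qed.

Lemma pres_mulg1 : right_id pres_one pres_mul.
Proof. by move=> a; rewrite -[a]pres_classK pres_class_cat cats0. Qed.

Lemma pres_mulVg : left_inverse pres_one pres_inv pres_mul.
Proof.
move=> a; rewrite -[a]pres_classK pres_class_inv pres_class_cat.
by apply/pres_classP; apply: pres_eq_mulVw.
Qed.

Lemma pres_mulgV : right_inverse pres_one pres_inv pres_mul.
Proof.
move=> a; rewrite -[a]pres_classK pres_class_inv pres_class_cat.
by apply/pres_classP; apply: pres_eq_mulwV.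
Qed.

HB.instance Definition _ := isGroup.Build presented
  pres_mulA pres_mul1g pres_mulg1 pres_mulVg pres_mulgV.

Definition pres_gen (x : X) : presented := pres_class [:: (x, false)].

Section Lift.
Variables (H : groupType) (f : X -> H).

Definition pres_eval (w : word X) : H :=
  \prod_(l <- w) (if l.2 then (f l.1)^-1 else f l.1).

(* Meaningful (a homomorphism extending f) only when f satisfies the
   relations R. *)
Definition pres_lift (g : presented) : H := pres_eval (repr g).

Hypothesis f_rel : forall u v, R u v -> pres_eval u = pres_eval v.

Lemma pres_eval_eq u v : pres_eq R u v -> pres_eval u = pres_eval v.
Proof.
elim=> {u v} [//|u v _ -> //|u v w _ -> _ -> //|u u' v v' _ IHu _ IHv|x b|//].
  by rewrite /pres_eval !big_cat -/(pres_eval _) IHu -/(pres_eval v) IHv.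
by rewrite /pres_eval !big_cons big_nil mulg1; case: b; rewrite ?mulgV ?mulVg.
Qed.

Lemma pres_lift_class w : pres_lift (pres_class w) = pres_eval w.
Proof. exact/pres_eval_eq/pres_repr_class. Qed.

Lemma pres_liftM : {morph pres_lift : g h / g * h}.
Proof.
move=> g h; rewrite [g * h]/(pres_mul g h) pres_lift_class.
by rewrite /pres_eval big_cat.
Qed.

Lemma pres_lift_gen x : pres_lift (pres_gen x) = f x.
Proof. by rewrite pres_lift_class /pres_eval big_seq1. Qed.

End Lift.
End PresentedGroup.

(* Indices are shifted by one: i : 'I_n.-1 with value k is the informal index
   k + 1, for all families of generators and for the points of 'S_n alike. *)
Inductive vsg_gen (n : nat) :=
| Sigma of 'I_n.-1
| Tau of 'I_n.-1
| Virt of 'I_n.-1.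

Section VsgGenChoice.
Variable n : nat.

Definition vsg_gen_enc (x : vsg_gen n) : 'I_n.-1 + 'I_n.-1 + 'I_n.-1 :=
  match x with
  | Sigma i => inl (inl i) | Tau i => inl (inr i) | Virt i => inr i
  end.

Definition vsg_gen_dec (y : 'I_n.-1 + 'I_n.-1 + 'I_n.-1) : vsg_gen n :=
  match y with
  | inl (inl i) => Sigma i | inl (inr i) => Tau i | inr i => Virt i
  end.

Lemma vsg_gen_encK : cancel vsg_gen_enc vsg_gen_dec.
Proof. by case. Qed.

HB.instance Definition _ := Countable.copy (vsg_gen n) (can_type vsg_gen_encK).

End VsgGenChoice.

Definition far (n : nat) (i j : 'I_n) : bool := (i.+1 < j) || (j.+1 < i).

Definition pword (n : nat) (s : seq (vsg_gen n)) : word (vsg_gen n) :=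
  [seq (x, false) | x <- s].

Inductive vsg_rel (n : nat) : word (vsg_gen n) -> word (vsg_gen n) -> Prop :=
| vsg_far_ss i j : far i j ->
    vsg_rel (pword [:: Sigma i; Sigma j]) (pword [:: Sigma j; Sigma i])
| vsg_far_vv i j : far i j ->
    vsg_rel (pword [:: Virt i; Virt j]) (pword [:: Virt j; Virt i])
| vsg_far_tt i j : far i j ->
    vsg_rel (pword [:: Tau i; Tau j]) (pword [:: Tau j; Tau i])
| vsg_far_st i j : far i j ->
    vsg_rel (pword [:: Sigma i; Tau j]) (pword [:: Tau j; Sigma i])
| vsg_far_sv i j : far i j ->
    vsg_rel (pword [:: Sigma i; Virt j]) (pword [:: Virt j; Sigma i])
| vsg_far_tv i j : far i j ->
    vsg_rel (pword [:: Tau i; Virt j]) (pword [:: Virt j; Tau i])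
| vsg_vv i : vsg_rel (pword [:: Virt i; Virt i]) [::]
| vsg_st i : vsg_rel (pword [:: Sigma i; Tau i]) (pword [:: Tau i; Sigma i])
| vsg_sss (i j : 'I_n.-1) : j = i.+1 :> nat ->
    vsg_rel (pword [:: Sigma i; Sigma j; Sigma i])
            (pword [:: Sigma j; Sigma i; Sigma j])
| vsg_vvv (i j : 'I_n.-1) : j = i.+1 :> nat ->
    vsg_rel (pword [:: Virt i; Virt j; Virt i]) (pword [:: Virt j; Virt i; Virt j])
| vsg_sst (i j : 'I_n.-1) : j = i.+1 :> nat ->
    vsg_rel (pword [:: Sigma i; Sigma j; Tau i])
            (pword [:: Tau j; Sigma i; Sigma j])
| vsg_sst' (i j : 'I_n.-1) : j = i.+1 :> nat ->
    vsg_rel (pword [:: Sigma j; Sigma i; Tau j])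
            (pword [:: Tau i; Sigma j; Sigma i])
| vsg_vsv (i j : 'I_n.-1) : j = i.+1 :> nat ->
    vsg_rel (pword [:: Virt i; Sigma j; Virt i]) (pword [:: Virt j; Sigma i; Virt j])
| vsg_vtv (i j : 'I_n.-1) : j = i.+1 :> nat ->
    vsg_rel (pword [:: Virt i; Tau j; Virt i]) (pword [:: Virt j; Tau i; Virt j]).

Definition VSG (n : nat) := presented (@vsg_rel n).

Lemma ltn_ord_pred (n : nat) (i : 'I_n.-1) : i < n.
Proof. exact: leq_trans (ltn_ord i) (leq_pred n). Qed.

Lemma ltn_ord_predS (n : nat) (i : 'I_n.-1) : i.+1 < n.
Proof. by rewrite -ltn_predRL. Qed.

Definition adj_tperm (n : nat) (i : 'I_n.-1) : 'S_n :=
  tperm (Ordinal (ltn_ord_pred i)) (Ordinal (ltn_ord_predS i)).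

Definition phi_gen (n : nat) (e : nat * nat * nat) (x : vsg_gen n) : 'S_n :=
  match x with
  | Sigma i => adj_tperm i ^+ e.1.1
  | Tau i => adj_tperm i ^+ e.1.2
  | Virt i => adj_tperm i ^+ e.2
  end.

Definition phi_triples : seq (nat * nat * nat) :=
  [:: (1, 1, 1); (1, 0, 1); (0, 0, 1)]%N.

(* A homomorphism when e \in phi_triples, by phiM below. *)
Definition phi (n : nat) (e : nat * nat * nat) : VSG n -> 'S_n :=
  pres_lift (phi_gen e).

Lemma adj_tperm2 n (i : 'I_n.-1) : adj_tperm i * adj_tperm i = 1.
Proof. exact: tperm2. Qed.

Lemma adj_tperm_far n (i j : 'I_n.-1) :
  far i j -> adj_tperm i * adj_tperm j = adj_tperm j * adj_tperm i.
Proof.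
move=> fij; apply/commgP/conjg_fixP; rewrite /adj_tperm tpermJ !tpermD //;
  by rewrite -val_eqE /=; move: fij; rewrite /far; lia.
Qed.

Lemma adj_tperm_braid n (i j : 'I_n.-1) : j = i.+1 :> nat ->
  adj_tperm i * (adj_tperm j * adj_tperm i) =
  adj_tperm j * (adj_tperm i * adj_tperm j).
Proof.
move=> ji; rewrite /adj_tperm.
set a := Ordinal (ltn_ord_pred i); set b := Ordinal (ltn_ord_predS i).
have -> : Ordinal (ltn_ord_pred j) = b by apply: val_inj.
set c := Ordinal (ltn_ord_predS j).
have nab : a != b by rewrite -val_eqE /= neq_ltn leqnn.
have nbc : b != c by rewrite -val_eqE /= ji neq_ltn leqnn.
have nac : a != c by rewrite -val_eqE /= ji neq_ltn ltnW.
have conj x y z w : tperm x y * (tperm z w * tperm x y)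
    = tperm (tperm x y z) (tperm x y w) :> 'S_n.
  by rewrite -tpermJ /conjg tpermV.
by rewrite !conj tpermR tpermL (tpermD nac nbc) tpermD // eq_sym.
Qed.

Lemma phi_gen_rel n (e : nat * nat * nat) : e \in phi_triples ->
  forall u v, vsg_rel u v ->
  pres_eval (phi_gen (n := n) e) u = pres_eval (phi_gen e) v.
Proof.
move=> eE u v; case=> i; try move=> j h; rewrite /pres_eval /=
  ?big_cons ?big_nil ?mulg1 /=;
  try (have C := adj_tperm_far h); try (have B := adj_tperm_braid h);
  move: eE; rewrite !inE => /or3P[] /eqP -> /=;
  by rewrite ?expg0 ?expg1 ?mulg1 ?mul1g ?adj_tperm2.
Qed.

Lemma phiM n e : e \in phi_triples -> {morph @phi n e : g h / g * h}.
Proof. by move=> eE; apply/pres_liftM/phi_gen_rel. Qed.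

Lemma phi_pres_gen n e : e \in phi_triples ->
  forall x : vsg_gen n, phi e (pres_gen _ x) = phi_gen e x.
Proof. by move=> eE; apply/pres_lift_gen/phi_gen_rel. Qed.

Definition outer_auts (gT : finGroupType) (G : {group gT}) : {set {perm gT}} :=
  Aut G :\: conj_aut G @* G.

(* S_6 acts on its six synthematic totals (the 1-factorisations of K_6), here
   numbered 0, ..., 5. Entry k of tot_tbl a b is the image of total k under
   the transposition (a b) of the six points. *)
Definition tot_tbl : seq (seq (seq nat)) :=
  ([:: [:: [:: 0; 1; 2; 3; 4; 5]; [:: 1; 0; 3; 2; 5; 4]; [:: 5; 3; 4; 1; 2; 0];
          [:: 4; 2; 1; 5; 0; 3]; [:: 3; 4; 5; 0; 1; 2]; [:: 2; 5; 0; 4; 3; 1]];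
      [:: [:: 1; 0; 3; 2; 5; 4]; [:: 0; 1; 2; 3; 4; 5]; [:: 2; 4; 0; 5; 1; 3];
          [:: 3; 5; 4; 0; 2; 1]; [:: 5; 2; 1; 4; 3; 0]; [:: 4; 3; 5; 1; 0; 2]];
      [:: [:: 5; 3; 4; 1; 2; 0]; [:: 2; 4; 0; 5; 1; 3]; [:: 0; 1; 2; 3; 4; 5];
          [:: 1; 0; 5; 4; 3; 2]; [:: 4; 5; 3; 2; 0; 1]; [:: 3; 2; 1; 0; 5; 4]];
      [:: [:: 4; 2; 1; 5; 0; 3]; [:: 3; 5; 4; 0; 2; 1]; [:: 1; 0; 5; 4; 3; 2];
          [:: 0; 1; 2; 3; 4; 5]; [:: 2; 3; 0; 1; 5; 4]; [:: 5; 4; 3; 2; 1; 0]];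
      [:: [:: 3; 4; 5; 0; 1; 2]; [:: 5; 2; 1; 4; 3; 0]; [:: 4; 5; 3; 2; 0; 1];
          [:: 2; 3; 0; 1; 5; 4]; [:: 0; 1; 2; 3; 4; 5]; [:: 1; 0; 4; 5; 2; 3]];
      [:: [:: 2; 5; 0; 4; 3; 1]; [:: 4; 3; 5; 1; 0; 2]; [:: 3; 2; 1; 0; 5; 4];
          [:: 5; 4; 3; 2; 1; 0]; [:: 1; 0; 4; 5; 2; 3]; [:: 0; 1; 2; 3; 4; 5]]])%N.

Definition tot (a b k : nat) : nat := nth 0 (nth [::] (nth [::] tot_tbl a) b) k.

Lemma all6P (P : nat -> bool) : all P (iota 0 6) -> forall i : 'I_6, P i.
Proof. by move/allP=> h i; apply: h; rewrite mem_iota /= ltn_ord. Qed.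

Lemma has6P (P : nat -> bool) : has P (iota 0 6) -> exists i : 'I_6, P i.
Proof.
by case/hasP=> i; rewrite mem_iota => i6 Pi; exists (@Ordinal 6 i i6).
Qed.

Section TotalAction.

Let all6 (P : nat -> bool) := all P (iota 0 6).

Lemma tot_lt (a b k : 'I_6) : tot a b k < 6.
Proof.
have: all6 (fun a => all6 (fun b => all6 (fun k => tot a b k < 6))) by [].
by move/all6P/(_ a)/all6P/(_ b)/all6P/(_ k).
Qed.

Definition tot_fun (a b k : 'I_6) : 'I_6 := Ordinal (tot_lt a b k).

Lemma tot_funK a b : involutive (tot_fun a b).
Proof.
move=> k; apply: val_inj => /=; apply/eqP.
have: all6 (fun a => all6 (fun b => all6 (fun k =>
  tot a b (tot a b k) == k))) by vm_compute.
by move/all6P/(_ a)/all6P/(_ b)/all6P/(_ k).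
Qed.

Definition tot_perm (a b : 'I_6) : 'S_6 := perm (inv_inj (tot_funK a b)).

Lemma tot_permE a b k : tot_perm a b k = tot a b k :> nat.
Proof. by rewrite permE. Qed.

Definition tot_rel (s t : 'S_6) : Prop :=
  forall a b k, t (tot_perm a b k) = tot_perm (s a) (s b) (t k).

Lemma tot_rel1 : tot_rel 1 1.
Proof. by move=> a b k; rewrite !perm1. Qed.

Lemma tot_relM s t s' t' :
  tot_rel s t -> tot_rel s' t' -> tot_rel (s * s') (t * t').
Proof. by move=> st st' a b k; rewrite !permM st st'. Qed.

Let sw (x y a : nat) := if a == x then y else if a == y then x else a.

Lemma tot_rel_tperm x y : tot_rel (tperm x y) (tot_perm x y).
Proof.
have tE (z : 'I_6) : tperm x y z = sw x y z :> nat.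
  by rewrite permE /= /sw -!val_eqE; do 2?case: ifP.
move=> a b k; apply/eqP; rewrite -val_eqE /= !tot_permE !tE.
have: all6 (fun x => all6 (fun y => all6 (fun a => all6 (fun b =>
  all6 (fun k => tot x y (tot a b k) ==
                 tot (sw x y a) (sw x y b) (tot x y k)))))) by vm_compute.
by move/all6P/(_ x)/all6P/(_ y)/all6P/(_ a)/all6P/(_ b)/all6P/(_ k).
Qed.

Lemma tot_rel_ex s : exists t, tot_rel s t.
Proof.
have [ts -> _] := prod_tpermP s; elim: ts => [|[x y] ts [t IH]].
  by exists 1; rewrite big_nil; apply: tot_rel1.
by exists (tot_perm x y * t); rewrite big_cons; apply: tot_relM (tot_rel_tperm _ _) IH.
Qed.

(* A permutation of the totals commuting with all tot_perm a b is trivial. *)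
Lemma tot_rel_uniq1 t : tot_rel 1 t -> t = 1.
Proof.
move=> ht; apply/permP => k; rewrite perm1; apply/esym/eqP; apply: contraT => nk.
have: all6 (fun k => all6 (fun j => (k != j) ==>
  has (fun a => has (fun b => has (fun c => has (fun d =>
   (tot a b k == tot c d k) && (tot a b j != tot c d j))
   (iota 0 6)) (iota 0 6)) (iota 0 6)) (iota 0 6))) by vm_compute.
move/all6P/(_ k)/all6P/(_ (t k))/implyP; rewrite val_eqE => /(_ nk).
case/has6P=> a /has6P[b] /has6P[c] /has6P[d] /andP[/eqP e /eqP[]].
have := ht a b k; have := ht c d k.
have -> : tot_perm c d k = tot_perm a b k.
  by apply: val_inj; rewrite /= !tot_permE.
by move=> -> /(congr1 val) /=; rewrite !tot_permE !perm1 => ->.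
Qed.

Lemma tot_relV s t : tot_rel s t -> tot_rel s^-1 t^-1.
Proof.
by move=> st a b k; apply: (@perm_inj _ t); rewrite permKV st !permKV.
Qed.

Lemma tot_rel_uniq s t t' : tot_rel s t -> tot_rel s t' -> t = t'.
Proof.
move=> st /tot_relV st'; have := tot_relM st st'; rewrite mulgV.
by move/tot_rel_uniq1 => /eqP; rewrite -eq_mulgV1 => /eqP.
Qed.

Lemma tot_rel_inj1 s : tot_rel s 1 -> s = 1.
Proof.
move=> h; apply/permP => x; rewrite perm1; apply/eqP; apply: contraT => nx.
have [y /andP[nyx nys]] : exists y, (y != x) && (s y != x).
  have /subsetPn[y _] : ~~ ([set: 'I_6] \subset [set x; s^-1 x]).
    apply/negP => /subset_leq_card; rewrite cardsT card_ord cards2.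
    by case: (_ != _).
  rewrite !inE negb_or => /andP[yx ys]; exists y; rewrite yx /=.
  by apply: contraNneq ys => <-; rewrite permK.
have: all6 (fun x => all6 (fun y => all6 (fun a => all6 (fun b =>
  [&& y != x, a != x & b != x] ==>
  has (fun k => tot x y k != tot a b k) (iota 0 6))))) by vm_compute.
move/all6P/(_ x)/all6P/(_ y)/all6P/(_ (s x))/all6P/(_ (s y))/implyP.
rewrite !val_eqE nyx nx nys => /(_ isT)/has6P[k] /eqP[].
by have /(congr1 val) := h x y k; rewrite /= !perm1 !tot_permE.
Qed.

Definition tot_aut (s : 'S_6) : 'S_6 :=
  odflt 1 [pick t : 'S_6 | `[< tot_rel s t >]].

Lemma tot_autP s : tot_rel s (tot_aut s).
Proof.
rewrite /tot_aut; case: pickP => [t /asboolP //|none].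
by have [t /asboolP] := tot_rel_ex s; rewrite none.
Qed.

Lemma tot_autM : {in [set: 'S_6] &, {morph tot_aut : s t / s * t}}.
Proof.
by move=> s t _ _; apply: tot_rel_uniq (tot_autP _) (tot_relM _ _);
   apply: tot_autP.
Qed.

Lemma tot_aut_injm : 'injm (Morphism tot_autM).
Proof.
apply/subsetP => s /morphpreP[_ /set1P /= e].
by apply/set1P/tot_rel_inj1; have := tot_autP s; rewrite e.
Qed.

Lemma tot_aut_im : Morphism tot_autM @* [set: 'S_6] = [set: 'S_6].
Proof.
by apply/eqP; rewrite eqEcard subsetT (card_injm tot_aut_injm) /=.
Qed.

(* The action of S_6 on its six totals. Any two outer automorphisms of S_6
   differ by an inner one, so up to conjugacy nu6 \o f does not depend on
   which outer automorphism is used. *)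
Definition nu6 : {perm 'S_6} := aut tot_aut_injm tot_aut_im.

Lemma nu6E s : nu6 s = tot_aut s.
Proof. by rewrite autE ?inE. Qed.

Lemma nu6P s a b k : nu6 s (tot_perm a b k) = tot_perm (s a) (s b) (nu6 s k).
Proof. by rewrite nu6E; apply: tot_autP. Qed.

Lemma nu6_tperm a b : nu6 (tperm a b) = tot_perm a b.
Proof. by rewrite nu6E; apply: tot_rel_uniq (tot_autP _) (tot_rel_tperm a b). Qed.

Lemma nu6_outer : nu6 \in outer_auts [set: 'S_6].
Proof.
rewrite inE Aut_aut andbT.
apply/negP => /morphimP[h _ _ e].
pose a := @Ordinal 6 0 isT; pose b := @Ordinal 6 1 isT.
pose c := @Ordinal 6 2 isT.
have := conj_autE (in_setT h) (in_setT (tperm a b)); rewrite -e nu6_tperm tpermJ.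
move/permP/(_ (h c)); rewrite tpermD ?(inj_eq perm_inj) //.
move/(congr1 val); rewrite /= tot_permE => /eqP.
have : all6 (fun k => tot 0 1 k != k) by [].
by move/all6P/(_ (h c))/negbTE => /= ->.
Qed.

End TotalAction.

Definition conjugate_homs (G H : groupType) (f1 f2 : G -> H) : Prop :=
  exists h : H, forall g : G, f2 g = h * f1 g * h^-1.

(* The image of f is an abelian group. *)
Definition abelian_hom (G H : groupType) (f : G -> H) : Prop :=
  forall x y : G, f x * f y = f y * f x.

(* Main.v *)
(* The images of the v_i satisfy the Coxeter relations of S_n, so they define a
   morphism S_n -> S_m. By simplicity of A_n it is either abelian, in which case
   the mixed relations make psi abelian, or injective, in which case n = m and
   it is an automorphism f of S_n. Then f^-1 \o psi sends v_i to (i i+1); as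
   sigma_1 and tau_1 commute with v_3, ..., v_{n-1} they go to powers of (1 2),
   and the remaining relations leave only the three homomorphisms phi.
   To determine f, let t be a transposition and w = f t: every w * w ^ h is the
   image of a product of two transpositions, so its order divides 6. This forces
   w to be a transposition (and then f is inner), or n = 6 and w to be a product
   of three disjoint transpositions (and then nu6^-1 \o f is inner). *)
Require Import Defs.
From mathcomp Require Import all_boot all_fingroup gseries alt zify.

Set Implicit Arguments.
Unset Strict Implicit.
Unset Printing Implicit Defensive.

Local Open Scope group_scope.

(** * Elementary rules for multiplicative maps *)

Section Morph.
Variables (G H : groupType) (f : G -> H).
Hypothesis fM : {morph f : x y / x * y}.

Lemma morph_one : f 1 = 1.
Proof. by apply: (mulgI (f 1)); rewrite -fM !mulg1. Qed.

Lemma morph_inv x : f x^-1 = (f x)^-1.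
Proof. by apply: (mulgI (f x)); rewrite -fM !mulgV morph_one. Qed.

Lemma morph_conj x y : f (x ^ y) = f x ^ f y.
Proof. by rewrite /conjg !fM morph_inv. Qed.

Lemma morph_exp x k : f (x ^+ k) = f x ^+ k.
Proof. by elim: k => [|k IHk]; rewrite ?expg0 ?morph_one // !expgS fM IHk. Qed.

End Morph.

(** * The Coxeter relations: a bound on the order, and maps out of S_n *)

Section CoxeterBound.
Variables (gT : finGroupType) (x : nat -> gT) (N : nat).
Hypothesis x2 : forall i, i < N -> x i * x i = 1.
Hypothesis x_far : forall i j, i.+1 < j -> j < N -> x i * x j = x j * x i.
Hypothesis x_braid : forall i, i.+1 < N ->
  x i * (x i.+1 * x i) = x i.+1 * (x i * x i.+1).

(* x_k x_{k-1} ... x_{k-d+1}, the Coxeter coset representatives. *)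
Fixpoint descent k d := if d is d'.+1 then descent k d' * x (k - d') else 1.

Lemma descent_far k d i : k < N -> i + d < k ->
  descent k d * x i = x i * descent k d.
Proof.
move=> kN; elim: d => [|d IHd] /= idk; first by rewrite mulg1 mul1g.
rewrite -mulgA -x_far; [|lia|lia].
by rewrite mulgA IHd ?mulgA //; lia.
Qed.

(** The descent contains x_{i+1} x_i. Move the x_{i+1} on the right leftwards up to this pair and
    braid; the leading x_i then commutes with x_k, ..., x_{i+2}. *)
Lemma descent_shift k d i : k < N -> i < k -> d <= k.+1 -> k < i + d ->
  descent k d * x i.+1 = x i * descent k d.
Proof.
move=> kN ik; elim: d => [|d IHd] dk kid /=; first lia.
have [kid'|idk] := ltnP k (i + d).
  rewrite -mulgA x_far; [|lia|lia].
  by rewrite mulgA IHd ?mulgA //; lia.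
have id_k : (i + d = k)%N by lia.
case: d {IHd} => [|d] in dk kid idk id_k *; first lia.
rewrite /=; have -> : (k - d = i.+1)%N by lia.
have -> : (k - d.+1 = i)%N by lia.
rewrite -!mulgA -x_braid; last lia.
by rewrite (mulgA _ (x i)) (@descent_far _ _ i) -?mulgA; [|lia..].
Qed.

Let G k := <<[set x i | i : 'I_k]>>.

Let xG i k : i < k -> x i \in G k.
Proof. by move=> ik; apply/mem_gen/imsetP; exists (Ordinal ik). Qed.

(** The union [U] of these cosets contains 1, so it is enough that right multiplication by each x_i
    with i <= k maps [U] into itself, that is, that x_i lies in the stabiliser of [U] under
    translations. *)
Lemma coxeter_coset_cover k : k < N ->
  G k.+1 \subset G k * [set descent k d | d : 'I_k.+2].
Proof.
move=> kN; set U := _ * _.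
have Umem g d : g \in G k -> d < k.+2 -> g * descent k d \in U.
  by move=> Gg dk; apply: mem_mulg => //; apply/imsetP; exists (Ordinal dk).
suff /subsetP GU : G k.+1 \subset 'N(U | 'R).
  apply/subsetP => g /GU Ug; rewrite -[g]mul1g -[_ * g]/('R%act 1 g).
  rewrite astabs_act //.
  by rewrite -[1]mulg1; apply: (Umem 1 0); rewrite ?group1.
rewrite gen_subG; apply/subsetP => _ /imsetP[[i ik] _ ->]; rewrite !inE /=.
apply/subsetP => _ /mulsgP[g _ Gg /imsetP[[d dk] _ ->] ->]; rewrite !inE /=.
(* If i + d < k, x_i passes through the descent into [G k]; if i + d > k + 1, it passes through as
   x_{i-1}. If i + d = k it lengthens the descent by one letter, and if i + d = k + 1 it cancels the
   last letter. *)
have [idk|dik] := ltnP (i + d) k.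
  by rewrite -mulgA descent_far // mulgA Umem // groupM // xG //; lia.
have [kid|idk] := ltnP k.+1 (i + d).
  case: i => [|i] in ik dik kid *; first lia.
  by rewrite -mulgA descent_shift ?mulgA; [|lia..]; rewrite Umem // groupM ?xG.
have [/esym idk'|ne] := eqVneq (i + d)%N k.
  rewrite -mulgA; have -> : i = (k - d)%N by lia.
  by apply: (Umem _ d.+1) => //; lia.
case: d => [|d] in dk dik idk ne *; first lia.
rewrite -mulgA /=; have -> : (k - d = i)%N by lia.
by rewrite -[_ * _ * x i]mulgA x2 ?mulg1; [apply: Umem|]; lia.
Qed.

(** Passing from [G k] to [G k.+1] costs at most a factor k + 2, the number of descents. *)
Lemma coxeter_card : #|<<[set x i | i : 'I_N]>>| <= N.+1`!.
Proof.
suff H k : k <= N -> #|G k| <= k.+1`! by apply: H.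
elim: k => [|k IHk] kN.
  suff -> : G 0 = 1 by rewrite cards1.
  by apply/trivgP; rewrite gen_subG; apply/subsetP => y /imsetP[[i i0]].
apply: leq_trans (subset_leq_card (coxeter_coset_cover kN)) _.
rewrite [X in #|pred_of_set X|]curry_imset2X.
apply: leq_trans (leq_imset_card _ _) _; rewrite cardsX factS mulnC.
apply: leq_mul (IHk _); last lia.
by apply: leq_trans (leq_imset_card _ _) _; rewrite card_ord.
Qed.

End CoxeterBound.

(** The transpositions (0 k) generate S_n, and for k > 0 conjugating (0 k) by (k k+1) gives (0
    k+1). *)
Lemma gen_adj_tperm n : 0 < n ->
  <<[set adj_tperm i | i : 'I_n.-1]>> = [set: 'S_n].
Proof.
case: n => [//|n] _; set G := <<_>>.
apply/eqP; rewrite eqEsubset subsetT -(gen_tperm ord0) gen_subG.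
have Gadj i : adj_tperm (n := n.+1) i \in G by apply/mem_gen/imset_f.
apply/subsetP => _ /imsetP[[k kn] _ ->]; elim: k kn => [|k IHk] kn.
  by rewrite (_ : Ordinal kn = ord0) ?tperm1 ?group1 //; apply: val_inj.
pose i : 'I_n.+1.-1 := Ordinal (kn : k < n.+1.-1).
have [k0|k0] := posnP k.
  suff -> : tperm ord0 (Ordinal kn) = adj_tperm i by [].
  by congr tperm; apply: val_inj; rewrite /= ?k0.
have -> : tperm ord0 (Ordinal kn) =
    tperm ord0 (Ordinal (ltnW kn)) ^ adj_tperm i.
  have ka : Ordinal (ltnW kn) = Ordinal (ltn_ord_pred i) by apply: val_inj.
  have kb : Ordinal kn = Ordinal (ltn_ord_predS i) by apply: val_inj.
  by rewrite tpermJ ka kb tpermL tpermD // -val_eqE /=; lia.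
by rewrite groupJ // IHk.
Qed.

(* The subgroup of the product generated by the pairs (s_i, v_i) has at most
   n! elements and projects onto 'S_n, hence is the graph of a morphism. *)
Lemma coxeter_lift n (gT : finGroupType) (v : 'I_n.-1 -> gT) :
    (forall i, v i * v i = 1) ->
    (forall i j, far i j -> v i * v j = v j * v i) ->
    (forall i j : 'I_n.-1, j = i.+1 :> nat ->
       v i * (v j * v i) = v j * (v i * v j)) ->
  exists2 f : 'S_n -> gT, {morph f : s t / s * t}
    & forall i, f (adj_tperm i) = v i.
Proof.
move=> v2 v_far v_braid.
pose w i := (adj_tperm i, v i).
(* [coxeter_card] takes a family indexed by [nat]; the value 1 beyond the range is arbitrary. *)
pose x i := if insub i is Some j then w j else 1.
have xE (i : 'I_n.-1) : x i = w i by rewrite /x valK.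
pose P := <<[set x i | i : 'I_n.-1]>>.
have xP i : w i \in P by rewrite -xE; apply/mem_gen/imsetP; exists i.
have cardP : #|P| <= #|[set: 'S_n]|.
  (* This covers n = 0 as well, since 0! = 1!. *)
  have -> : #|[set: 'S_n]| = n.-1.+1`!.
    by rewrite cardsT card_Sn; case: (n).
  apply: coxeter_card => [i iN|i j ij jN|i iN].
  - rewrite -[i]/(val (Ordinal iN)) xE.
    by congr (_, _); rewrite ?v2 ?adj_tperm2.
  - have iN : i < n.-1 by lia.
    rewrite -[i]/(val (Ordinal iN)) -[j]/(val (Ordinal jN)) !xE.
    have fij : far (Ordinal iN) (Ordinal jN) by rewrite /far /= ij.
    exact: (congr2 pair) (adj_tperm_far fij) (v_far _ _ fij).
  rewrite -[i.+1]/(val (Ordinal iN)) -[i]/(val (Ordinal (ltnW iN))) !xE.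
  exact: (congr2 pair) (adj_tperm_braid _) (v_braid _ _ _).
have fstP : [set p.1 | p in P] = [set: 'S_n].
  case: (posnP n) => [n0|n_gt0].
    have n1 : n`! = 1%N by rewrite n0.
    apply/eqP; rewrite eqEcard subsetT /= cardsT card_Sn n1 card_gt0.
    by apply/set0Pn; exists 1; apply/imsetP; exists 1; rewrite ?group1.
  apply/eqP; rewrite eqEsubset subsetT -(gen_adj_tperm n_gt0).
  have -> : [set p.1 | p in P] = [morphism of fst] @* P.
    by rewrite morphimEsub ?subsetT.
  rewrite gen_subG; apply/subsetP => _ /imsetP[i _ ->].
  by apply/morphimP; exists (w i); rewrite ?inE.
have injP : {in P &, injective fst}.
  apply/imset_injP; rewrite eqn_leq leq_imset_card fstP.
  by rewrite cardP.
have exP s : exists t, (s, t) \in P.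
  have : s \in [set p.1 | p in P] by rewrite fstP inE.
  by case/imsetP => -[a t] Pt /= ->; exists t.
pose f s := odflt 1 [pick t | (s, t) \in P].
have fP s : (s, f s) \in P.
  by rewrite /f; case: pickP => // none; have [t] := exP s; rewrite none.
have fE s t : (s, t) \in P -> f s = t.
  by move=> Pst; have /(congr1 snd) := injP _ _ (fP s) Pst erefl.
exists f => [s t|i]; last exact: fE (xP i).
exact: fE (groupM (fP s) (fP t)).
Qed.

(** * Homomorphisms out of a symmetric group *)

Lemma ex_notin (T : finType) (s : seq T) :
  size s < #|T| -> exists x, x \notin s.
Proof.
move=> ss; apply/existsP; rewrite -negb_forall.
apply: contraL ss => /forallP sT.
rewrite -leqNgt -cardsT; apply: leq_trans (card_size s).
by apply/subset_leq_card/subsetP => x _; apply: sT.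
Qed.

(** The kernel meets the simple group ['Alt_T] in a normal subgroup. If this is all of ['Alt_T], the
    kernel contains every commutator and the image is abelian. If it is trivial, then for s in the
    kernel each [s, t] is an even element of the kernel, hence 1; so s is central, hence trivial. *)
Lemma sym_hom_abelian_or_inj (T : finType) (gT : groupType)
    (f : {perm T} -> gT) :
    4 < #|T| -> {morph f : s t / s * t} ->
  (forall s t, f s * f t = f t * f s) \/ injective f.
Proof.
move=> T5 fM.
have f1 := morph_one fM.
have fV := morph_inv fM.
pose K := [set s | f s == 1].
have Kgroup : group_set K.
  apply/group_setP; split=> [|s t]; rewrite !inE ?f1 //.
  by rewrite fM => /eqP-> /eqP->; rewrite mulg1.
have KJ s t : s \in K -> s ^ t \in K.
  by rewrite !inE /conjg !fM fV => /eqP->; rewrite mul1g mulVg.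
have AltR s t : [~ s, t] \in 'Alt_T.
  by rewrite Alt_even odd_permM odd_permV odd_permJ addbb.
pose KA := [group of Group Kgroup :&: 'Alt_T].
have KAn : KA <| 'Alt_T.
  rewrite /normal subsetIr; apply/subsetP => t At; rewrite inE.
  apply/subsetP => _ /imsetP[s /setIP[Ks As] ->].
  by rewrite inE KJ ?groupJ.
have [_ /(_ _ KAn)[KA1|KAA]] := simpleP _ (simple_Alt5 T5); last first.
  left=> s t; rewrite -!fM commgC (fM (t * s)).
  have /setIP[] : [~ s, t] \in KA by rewrite KAA AltR.
  by rewrite inE => /eqP -> _; rewrite mulg1.
right; suff K1 s : f s = 1 -> s = 1.
  move=> s t fst; apply/eqP; rewrite eq_mulgV1; apply/eqP/K1.
  by rewrite fM fV fst mulgV.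
move=> fs.
have sC t : [~ s, t] = 1.
  apply/set1gP; rewrite -KA1 inE AltR andbT /= commgEl.
  have Ks : s \in Group Kgroup by rewrite inE fs.
  by apply: (@groupM _ (Group Kgroup)); [rewrite groupV | apply: KJ].
apply/permP => a; rewrite perm1; apply/eqP; apply: contraT => na.
(* A central s fixes (a b) under conjugation. But (a b) fixes the point s a, while its conjugate (s
   a s b) moves it to s b. *)
have [b] := ex_notin (ltnW (ltnW T5) : size [:: a; s a] < #|T|).
rewrite !inE negb_or => /andP[ba bs].
have tJ : tperm a b ^ s = tperm a b.
  by apply/conjg_fixP/commgP/commute_sym/commgP/eqP/sC.
have := tpermJ a b s; rewrite tJ => /permP/(_ (s a)).
rewrite tpermL tpermD ?(eq_sym a) ?bs // => /perm_inj e.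
by rewrite e eqxx in ba.
Qed.

Lemma morph_eq_gen (aT rT : finGroupType) (S : {set aT}) (f g : aT -> rT) :
    <<S>> = [set: aT] -> {morph f : s t / s * t} -> {morph g : s t / s * t} ->
  {in S, f =1 g} -> f =1 g.
Proof.
move=> genS fM gM fg.
have E : group_set [set s | f s == g s].
  apply/group_setP; split=> [|s t].
    by rewrite inE (morph_one fM) (morph_one gM).
  by rewrite !inE fM gM => /eqP-> /eqP->.
suff /subsetP H : [set: aT] \subset Group E.
  by move=> s; apply/eqP; have := H s (in_setT s); rewrite inE.
by rewrite -genS gen_subG; apply/subsetP => s Ss; rewrite inE fg.
Qed.

(** * Transpositions and involutions *)

Lemma perm_cycle_ex (T : finType) (x0 : T) (s : seq T) : uniq s ->
  exists h : {perm T},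
    forall i, i < size s -> h (nth x0 s i) = nth x0 (rot 1%N s) i.
Proof.
move=> us; exists (perm (can_inj (prev_next us))) => i si.
rewrite permE next_nth mem_nth // index_uniq //.
case: s us si => [//|y s] us si; rewrite rot1_cons nth_rcons.
have [sis|] := ltnP i (size s); first exact: set_nth_default.
move=> sis; have -> : i = size s by rewrite /= in si; lia.
by rewrite eqxx nth_default.
Qed.

Section Transpositions.
Variable T : finType.
Implicit Types (a b c d x y : T) (w : {perm T}).

Lemma tperm_commute_or_meet a b c d :
  commute (tperm a b) (tperm c d) \/ [|| a == c, a == d, b == c | b == d].
Proof.
case: (boolP [|| _, _, _ | _]) => [|/norP[ac /norP[ad /norP[bc bd]]]].
  by right.
by left; apply/commgP/conjg_fixP; rewrite tpermJ !tpermD // eq_sym.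
Qed.

(** The square is 1 when the factors commute. Otherwise they share a point, which symmetry makes the
    first entry of both, and the braid relation makes the cube 1. *)
Lemma tperm_mul6 a b c d : (tperm a b * tperm c d) ^+ 6 = 1.
Proof.
have sq x y : tperm x y ^+ 2 = 1 by rewrite expgS expg1 tperm2.
have [cm|] := tperm_commute_or_meet a b c d.
  by rewrite (expgM _ 2 3) (expgMn 2 cm) !sq mulg1 expg1n.
suff H x y z : (tperm x y * tperm x z) ^+ 6 = 1.
  by case/or4P => /eqP->; rewrite // tpermC // [tperm c _]tpermC // tpermC.
rewrite (expgM _ 3 2).
have [->|xy] := eqVneq x y.
  by rewrite tperm1 mul1g -(expgM _ 3 2) (expgM _ 2 3) sq expg1n.
have [->|xz] := eqVneq x z.
  by rewrite tperm1 mulg1 -(expgM _ 3 2) (expgM _ 2 3) sq expg1n.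
have [->|yz] := eqVneq y z.
  by rewrite tperm2 !expg1n.
have braid : tperm x y * (tperm x z * tperm x y)
           = tperm x z * (tperm x y * tperm x z).
  have conj p q r s : tperm p q * (tperm r s * tperm p q)
      = tperm (tperm p q r) (tperm p q s) :> {perm T}.
    by rewrite -tpermJ /conjg tpermV.
  by rewrite !conj !tpermL (tpermD xz yz) (tpermD xy) ?(tpermC z y) // eq_sym.
suff -> : (tperm x y * tperm x z) ^+ 3 = 1 by rewrite expg1n.
rewrite !expgS expg0 mulg1 -!mulgA -braid (mulgA (tperm x y) (tperm x y)).
by rewrite tperm2 mul1g (mulgA (tperm x z)) tperm2 mul1g tperm2.
Qed.

Lemma tperm_conj_ex a b x y : a != b -> x != y ->
  exists s : {perm T}, tperm x y = tperm a b ^ s.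
Proof.
move=> ab xy; exists (tperm a x * tperm (tperm a x b) y).
rewrite conjgM !tpermJ tpermL tpermL tpermD // 1?eq_sym //.
by rewrite -{1}(tpermL a x) (inj_eq perm_inj).
Qed.

End Transpositions.

Section Involutions.
Variable T : finType.
Implicit Types (a b c d x y : T) (w : {perm T}).

Lemma involution_extend w c (s : seq T) : involutive w -> uniq s ->
    {in s, forall x, w x \in s} -> c \notin s -> w c != c ->
  uniq [:: c, w c & s].
Proof.
move=> wK us sw cs wc; rewrite /= inE negb_or eq_sym wc cs us andbT /=.
by rewrite andbT; apply: contra cs => /sw; rewrite wK.
Qed.

(* If w is neither a transposition nor fixed-point free on six points, some
   product w * w ^ h contains a 5-cycle or a 4-cycle. *)
Lemma involution_conj_product_order w : 4 < #|T| -> w != 1 -> involutive w ->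
    (forall h : {perm T}, (w * w ^ h) ^+ 6 = 1) ->
  (exists a b, a != b /\ w = tperm a b) \/
  (#|T| = 6 /\ forall x, w x != x).
Proof.
move=> T5 w1 wK wh6.
have [a wa] : exists a, w a != a.
  apply/existsP; rewrite -negb_forall; apply: contra w1 => /forallP w1.
  by apply/eqP/permP => a; rewrite perm1; apply/eqP.
set b := w a; have wb : w b = a by apply: wK.
have Uab : uniq [:: a; b] by apply: involution_extend.
have cab x : x \in [:: a; b] -> w x \in [:: a; b].
  by rewrite !inE => /orP[]/eqP->; rewrite ?wb eqxx ?orbT.
case: (boolP [exists c, (c \notin [:: a; b]) && (w c != c)]); last first.
  rewrite negb_exists => /forallP fixed; left; exists a, b; split.
    by rewrite eq_sym.
  apply/permP => x; case: tpermP => [->|->|/eqP xa /eqP xb] //.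
  have := fixed x; rewrite !inE negb_and !negbK => /orP[|/eqP //].
  by rewrite (negbTE xa) (negbTE xb).
case/existsP => c /andP[cN wc].
set d := w c; have wd : w d = c by apply: wK.
have Ucd : uniq [:: c; d; a; b] by apply: involution_extend.
have ccd x : x \in [:: c; d; a; b] -> w x \in [:: c; d; a; b].
  rewrite 2!inE => /or3P[/eqP->|/eqP->|/cab]; rewrite ?wd !inE ?eqxx ?orbT //.
  by case/orP => ->; rewrite ?orbT.
have conjE (h : {perm T}) x y : h x = y -> (w ^ h) y = h (w x).
  by move=> <-; rewrite permJ.
(* The sixth-power hypothesis read pointwise; in a product the left factor acts first. *)
have iter6 (h : {perm T}) x : iter 6 (fun y => (w ^ h) (w y)) x = x.
  by rewrite (eq_iter (fun y => esym (permM w (w ^ h) y))) -permX wh6 perm1.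
case: (boolP [exists e, w e == e]) => [/existsP[e /eqP we]|].
  have eN : e \notin [:: c; d; a; b].
    have nca : c != a by apply: contraNneq cN => ->; rewrite inE eqxx.
    rewrite !inE !negb_or; apply/and4P.
    split; apply: contra wa => /eqP E; move: we; rewrite E ?wd ?wb -/d -/b.
    - by move=> dc; rewrite -/d dc eqxx in wc.
    - by move=> dc; rewrite -/d {1}dc eqxx in wc.
    - by move=> ->.
    by move=> <-.
  have U : uniq [:: a; b; c; d; e].
    rewrite (perm_uniq (s2 := e :: [:: c; d; a; b])) ?cons_uniq ?eN //.
    by apply/seq.permP => p /=; do 5!case: (p _).
  (* Here w swaps a with b and c with d, and fixes e. For this h the product [w * w ^ h] contains
     the 5-cycle (a c e d b), so its sixth power sends a to c. *)
  have [h hE] := perm_cycle_ex a U.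
  have ha : h a = b := hE 0 isT; have hb : h b = c := hE 1%N isT.
  have hc : h c = d := hE 2 isT; have hd : h d = e := hE 3 isT.
  have he : h e = a := hE 4 isT.
  have := iter6 h a; rewrite /= -/b (conjE _ _ _ ha) -/b hb.
  rewrite -/d (conjE _ _ _ hc) -/d hd we (conjE _ _ _ hd) wd hc.
  rewrite wd (conjE _ _ _ hb) wb ha wb (conjE _ _ _ he) we he.
  rewrite -/b (conjE _ _ _ ha) -/b hb => ca.
  by rewrite ca inE eqxx in cN.
rewrite negb_exists => /forallP fpf; right; split=> //.
apply/eqP; rewrite eq_sym; apply: contraT => T6.
have [e eN] := ex_notin (T5 : size [:: c; d; a; b] < #|T|).
set f := w e; have wf : w f = e by apply: wK.
have Uef : uniq [:: e; f; c; d; a; b] by apply: involution_extend.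
(* Three swapped pairs have been found, so excluding six points leaves room for a fourth. *)
have T7 : 6 < #|T|.
  rewrite ltn_neqAle T6 -[6]/(size [:: e; f; c; d; a; b]).
  by rewrite -(card_uniqP Uef) max_card.
have [g gN] := ex_notin (T7 : size [:: e; f; c; d; a; b] < #|T|).
set i := w g; have wi : w i = g by apply: wK.
have Ugi : uniq [:: g; i; e; f; c; d; a; b].
  apply: involution_extend => // x.
  rewrite 2!inE => /or3P[/eqP->|/eqP->|/ccd]; rewrite ?wf !inE ?eqxx ?orbT //.
  by case/or4P => ->; rewrite ?orbT.
(* For this h the product [w * w ^ h] contains the 4-cycle (a g e c), so its sixth power sends a to
   e. *)
have [h hE] := perm_cycle_ex a Ugi.
have hg : h g = i := hE 0 isT; have hi : h i = e := hE 1%N isT.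
have he : h e = f := hE 2 isT; have hf : h f = c := hE 3 isT.
have hc : h c = d := hE 4 isT; have hd : h d = a := hE 5 isT.
have ha : h a = b := hE 6 isT; have hb : h b = g := hE 7 isT.
have := iter6 h a; rewrite /= -/b (conjE _ _ _ ha) -/b hb.
rewrite -/i (conjE _ _ _ hg) -/i hi -/f (conjE _ _ _ he) -/f hf.
rewrite -/d (conjE _ _ _ hc) -/d hd -/b (conjE _ _ _ ha) -/b hb.
rewrite -/i (conjE _ _ _ hg) -/i hi => ea.
by rewrite ea !inE eqxx !orbT in eN.
Qed.

End Involutions.

(** * Automorphisms of S_n *)

(** Distinct transpositions (x0 y) do not commute, so their images pairwise share a point. In fact
    all these images contain one point a; then h sends x0 to a and any other y to the second point
    of the image of (x0 y). The star of transpositions at x0 generates the group. *)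
Lemma tperm_preserving_inner (T : finType) (f : {perm T} -> {perm T}) :
    2 < #|T| -> {morph f : s t / s * t} -> injective f ->
    (forall x y, x != y -> exists a b, a != b /\ f (tperm x y) = tperm a b) ->
  exists h, forall s, f s = s ^ h.
Proof.
move=> T3 fM fI ft.
have [x0 [x1 [x2 [_ [n01 n12 n20]]]]] := card_gt2P T3.
have f1 := morph_one fM.
have fV := morph_inv fM.
have fJ := morph_conj fM.
have star_inj y z : tperm x0 y = tperm x0 z -> y = z.
  by move/permP/(_ x0); rewrite !tpermL.
have ncomm y z : x0 != y -> x0 != z -> y != z ->
    ~ commute (f (tperm x0 y)) (f (tperm x0 z)).
  move=> n0y n0z nyz; rewrite /commute -!fM => /fI /permP /(_ y).
  rewrite !permM tpermR tpermL (tpermD n0y) 1?eq_sym // tpermR => z0.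
  by rewrite z0 eqxx in n0z.
have meet y z p q r s : x0 != y -> x0 != z -> y != z ->
    f (tperm x0 y) = tperm p q -> f (tperm x0 z) = tperm r s ->
  [|| p == r, p == s, q == r | q == s].
  move=> n0y n0z nyz Ey Ez; case: (tperm_commute_or_meet p q r s) => //.
  by rewrite -Ey -Ez => /ncomm; case.
have n02 : x0 != x2 by rewrite eq_sym.
have [a [b [c [nab nac Eb Ec]]]] : exists a b c,
    [/\ a != b, a != c, f (tperm x0 x1) = tperm a b
      & f (tperm x0 x2) = tperm a c].
  have [p [q [npq Ep]]] := ft _ _ n01.
  have [r [s [nrs Er]]] := ft _ _ n02.
  have := meet _ _ _ _ _ _ n01 n02 n12 Ep Er.
  case/or4P => /eqP E; subst.
  - by exists r, q, s.
  - by exists s, q, r; split; rewrite // 1?eq_sym // [RHS]tpermC.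
  - by exists r, p, s; split; rewrite // 1?eq_sym // [RHS]tpermC.
  by exists s, p, r; split; rewrite // 1?eq_sym // [RHS]tpermC.
have nbc : b != c.
  by apply: contra_neq n12 => E; apply/star_inj/fI; rewrite Eb Ec E.
(* An image avoiding a but meeting both (a b) and (a c) would be (b c), which is already the image
   of (x1 x2). *)
have fstar y : f (tperm x0 y) = tperm a (f (tperm x0 y) a).
  have [<-|n0y] := eqVneq x0 y; first by rewrite tperm1 f1 perm1 tperm1.
  have [p [q [npq E]]] := ft _ _ n0y.
  have [ap|nap] := eqVneq a p; first by rewrite E ap tpermL.
  have [aq|naq] := eqVneq a q; first by rewrite E aq tpermR tpermC.
  have [y1|ny1] := eqVneq y x1; first by rewrite y1 Eb tpermL.
  have [y2|ny2] := eqVneq y x2; first by rewrite y2 Ec tpermL.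
  have := meet _ _ _ _ _ _ n0y n01 ny1 E Eb.
  have := meet _ _ _ _ _ _ n0y n02 ny2 E Ec.
  rewrite !(eq_sym _ a) (negbTE nap) (negbTE naq) /= => Mc Mb.
  have Ebc : f (tperm x0 y) = tperm c b.
    rewrite E; case/orP: Mc => /eqP Mc; case/orP: Mb => /eqP Mb; subst => //.
    - by rewrite eqxx in nbc.
    - by rewrite tpermC.
    by rewrite eqxx in nbc.
  have : tperm x0 y = tperm x0 x2 ^ tperm x0 x1.
    by apply: fI; rewrite Ebc fJ Eb Ec tpermJ tpermL tpermD // tpermC.
  rewrite tpermJ tpermL tpermD // => /permP /(_ x0).
  rewrite tpermL tpermD // 1?eq_sym // => y0.
  by rewrite y0 eqxx in n0y.
have gI : injective (fun y => f (tperm x0 y) a).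
  by move=> y z E; apply/star_inj/fI; rewrite fstar E -fstar.
exists (perm gI); apply: (morph_eq_gen (gen_tperm x0)) => // [s t|s].
  by rewrite conjMg.
case/imsetP => y _ ->; rewrite tpermJ !permE tperm1 f1 perm1.
exact: fstar.
Qed.

(* With 0 <-> b, c <-> d and e <-> f the pairs swapped by w, this is a check of
   the 120 possible tuples (b, c, d, e, f). *)
Lemma fpf_involution_tot_perm (w : 'S_6) : involutive w ->
  (forall x, w x != x) -> exists x y, x != y /\ w = tot_perm x y.
Proof.
move=> wK fpf; set a : 'I_6 := ord0.
set b := w a; have wb : w b = a by apply: wK.
have Uab : uniq [:: a; b] by apply: involution_extend.
have [c cN] : exists c, c \notin [:: a; b] by apply: ex_notin; rewrite card_ord.
set d := w c; have wd : w d = c by apply: wK.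
have Ucd : uniq [:: c; d; a; b].
  apply: involution_extend => // x.
  by rewrite !inE => /orP[]/eqP->; rewrite ?wb eqxx ?orbT.
have [e eN] : exists e, e \notin [:: c; d; a; b].
  by apply: ex_notin; rewrite card_ord.
set f := w e; have wf : w f = e by apply: wK.
have Uef : uniq [:: e; f; c; d; a; b].
  apply: involution_extend => // x.
  by rewrite !inE => /or4P[]/eqP->; rewrite ?wb ?wd eqxx ?orbT.
pose all6 (P : nat -> bool) := all P (iota 0 6).
pose has6 (P : nat -> bool) := has P (iota 0 6).
(* The nested [if] stops the evaluation as soon as a partial tuple has a repeated entry. *)
have H : all6 (fun b => if ~~ uniq [:: 0; b] then true else
  all6 (fun c => if ~~ uniq [:: c; 0; b] then true else
  all6 (fun d => if ~~ uniq [:: c; d; 0; b] then true else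
  all6 (fun e => if ~~ uniq [:: e; c; d; 0; b] then true else
  all6 (fun f => if ~~ uniq [:: e; f; c; d; 0; b] then true else
  has6 (fun x => has6 (fun y => [&& x != y, tot x y 0 == b, tot x y b == 0,
    tot x y c == d, tot x y d == c, tot x y e == f & tot x y f == e]))))))).
  by vm_compute.
have Uv (s : seq 'I_6) : uniq s -> uniq (map val s).
  by rewrite map_inj_uniq //; apply: val_inj.
have := all6P H b; rewrite (Uv _ Uab : uniq [:: 0; val b]).
have Ucab : uniq [:: c; a; b] by rewrite cons_uniq cN.
move/all6P/(_ c); rewrite (Uv _ Ucab : uniq [:: val c; 0; val b]).
move/all6P/(_ d); rewrite (Uv _ Ucd : uniq [:: val c; val d; 0; val b]).
have Uecd : uniq [:: e; c; d; a; b] by rewrite cons_uniq eN.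
move/all6P/(_ e); rewrite (Uv _ Uecd : uniq [:: val e; val c; val d; 0; val b]).
move/all6P/(_ f).
rewrite (Uv _ Uef : uniq [:: val e; val f; val c; val d; 0; val b]).
case/has6P => x /has6P[y] /and5P[xy /eqP Ta /eqP Tb /eqP Tc].
case/and3P => /eqP Td /eqP Te /eqP Tf.
exists x, y; split=> //; apply/permP => z; apply/val_inj; rewrite /= tot_permE.
have : z \in [:: e; f; c; d; a; b].
  have [||_ ->] := uniq_min_size Uef (s2 := enum 'I_6).
  - by move=> u _; rewrite mem_enum.
  - by rewrite size_enum_ord.
  by rewrite mem_enum.
by rewrite !inE => /or4P[/eqP->|/eqP->|/eqP->|/or3P[]/eqP->];
  rewrite ?wb ?wd ?wf ?Ta ?Tb ?Tc ?Td ?Te ?Tf.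
Qed.

Lemma nu6M : {morph nu6 : s t / s * t}.
Proof. by move=> s t; rewrite !nu6E tot_autM ?inE. Qed.

Lemma sym_aut_inner_or_nu6 n (f : 'S_n -> 'S_n) :
    4 < n -> {morph f : s t / s * t} -> injective f ->
  exists h, (forall s, f s = s ^ h) \/
    exists E : n = 6,
      forall s, cast_perm E (f s) = nu6 (cast_perm E s) ^ cast_perm E h.
Proof.
move=> n5 fM fI.
have f1 := morph_one fM.
have fV := morph_inv fM.
have fJ := morph_conj fM.
have fX := morph_exp fM.
have [g fK gK] := injF_bij fI.
have fT x y : x != y -> involutive (f (tperm x y)) /\
    ((exists a b, a != b /\ f (tperm x y) = tperm a b) \/
     (n = 6 /\ forall z, f (tperm x y) z != z)).
  move=> xy; set w := f _.
  have wK : involutive w by move=> z; rewrite -permM -fM tperm2 f1 perm1.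
  split=> //; have := @involution_conj_product_order _ w; rewrite !card_ord.
  apply=> //.
    apply: contra_neq xy => w1; have /permP/(_ x) : tperm x y = 1.
      by apply: fI; rewrite f1.
    by rewrite tpermL perm1.
  (* As f is onto, [w ^ h] is the image of a transposition too, so [w * w ^ h] is the image of a
     product of two transpositions. *)
  by move=> h; rewrite -[h]gK -fJ -fM -fX tpermJ tperm_mul6 f1.
pose x0 : 'I_n := Ordinal (ltn_trans (ltn0Sn 3) n5).
pose x1 : 'I_n := Ordinal (leq_trans (isT : 1 < 5) n5).
(* All transpositions are conjugate, so the image of (0 1) alone decides between the two cases. *)
have n01 : x0 != x1 by [].
have [_ [[a [b [nab fab]]]|[n6 fpf]]] := fT _ _ n01.
  have [|x y nxy|h fE] := @tperm_preserving_inner _ f _ fM fI.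
  - by rewrite card_ord; lia.
  - have [s ->] := tperm_conj_ex n01 nxy; exists (f s a), (f s b).
    by rewrite fJ fab tpermJ (inj_eq perm_inj).
  by exists h; left.
subst n.
have fnu x y : x != y -> exists a b, a != b /\ f (tperm x y) = nu6 (tperm a b).
  move=> nxy; have [wK _] := fT _ _ nxy.
  have [s xyE] := tperm_conj_ex n01 nxy.
  have [|a [b [nab ->]]] := fpf_involution_tot_perm wK.
    move=> z; rewrite xyE fJ -[z](permKV (f s)) permJ (inj_eq perm_inj).
    exact: fpf.
  by exists a, b; rewrite nu6_tperm.
(* By [fnu], this map takes transpositions to transpositions, so it is inner. *)
pose k s := nu6^-1 (f s).
have kM : {morph k : s t / s * t}.
  by move=> s t; apply: (@perm_inj _ nu6); rewrite nu6M /k !permKV fM.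
have kI : injective k by move=> s t /perm_inj/fI.
have [|x y nxy|h kE] := @tperm_preserving_inner _ k _ kM kI.
- by rewrite card_ord.
- by have [a [b [nab E]]] := fnu _ _ nxy; exists a, b; rewrite /k E permK.
(* Applying [nu6] to s ^ h turns the conjugator h into [nu6 h]. *)
exists (nu6 h); right; exists erefl => s; rewrite !cast_perm_id.
rewrite -[f s](permKV nu6) -/(k s) kE; apply: (mulgI (nu6 h)).
by rewrite -nu6M -conjgC -conjgC nu6M.
Qed.

(** * Homomorphisms out of VSG_n *)

Section VsgHom.
Variables (n : nat) (H : groupType).
Local Notation gen x := (pres_gen (@vsg_rel n) x).

Lemma vsg_ind (P : VSG n -> Prop) : P 1 ->
    (forall x g, P g -> P (gen x * g)) ->
    (forall x g, P g -> P ((gen x)^-1 * g)) -> forall g, P g.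
Proof.
move=> P1 PM PV g.
have [w ->] : exists w, g = pres_class _ w.
  exact: ex_intro (esym (pres_classK g)).
elim: w => [//|[x b] w IHw].
rewrite -cat1s -pres_class_cat; case: b.
  rewrite -[[:: (x, true)]]/(winv [:: (x, false)]) -pres_class_inv; exact: PV.
exact: PM.
Qed.

Lemma vsg_hom_eq (f g : VSG n -> H) : {morph f : x y / x * y} ->
    {morph g : x y / x * y} -> (forall x, f (gen x) = g (gen x)) -> f =1 g.
Proof.
move=> fM gM fg.
apply: vsg_ind => [|x y E|x y E].
- by rewrite (morph_one fM) (morph_one gM).
- by rewrite fM gM fg E.
by rewrite fM gM (morph_inv fM) (morph_inv gM) fg E.
Qed.

Lemma vsg_hom_rel (f : VSG n -> H) s t : {morph f : x y / x * y} ->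
    vsg_rel (pword s) (pword t) ->
  \prod_(x <- s) f (gen x) = \prod_(x <- t) f (gen x).
Proof.
move=> fM st.
have one := morph_one fM.
have E u : f (pres_class _ (pword u)) = \prod_(x <- u) f (gen x).
  elim: u => [|x u IHu]; first by rewrite big_nil -one.
  by rewrite big_cons -IHu -fM [gen x * _]pres_class_cat.
by rewrite -!E; congr f; apply/pres_classP; apply: pres_eq_rel.
Qed.

End VsgHom.

Lemma commute_adj_tperm_stable n (s : 'S_n) (p q : 'I_n) :
    p != q -> commute s (tperm p q) ->
  s p \in [:: p; q] /\ s q \in [:: p; q].
Proof.
move=> pq /commute_sym/commgP/conjg_fixP; rewrite tpermJ => E.
have stable x : tperm p q x != x -> x \in [:: p; q].
  apply: contraR; rewrite !inE negb_or => /andP[xp xq].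
  by rewrite tpermD // eq_sym.
by split; apply: stable; rewrite -E ?tpermL ?tpermR (inj_eq perm_inj) // eq_sym.
Qed.

(** The first element u_0 commutes with (j j+1) for all j >= 2, which forces it to fix every point
    from 2 on; so it is a power of (0 1). The mixed relation determines u_{k+1} from u_k and carries
    the same exponent along. *)
Lemma adj_tperm_twist n (u : 'I_n.-1 -> 'S_n) : 4 < n ->
    (forall i j, far i j -> u i * adj_tperm j = adj_tperm j * u i) ->
    (forall i j : 'I_n.-1, j = i.+1 :> nat ->
       adj_tperm i * (u j * adj_tperm i) = adj_tperm j * (u i * adj_tperm j)) ->
  exists e : bool, forall i, u i = adj_tperm i ^+ e.
Proof.
move=> n5 u_far u_mixed.
have n1 : 0 < n.-1 by lia.
pose s := u (Ordinal n1).
have s_adj (p q : 'I_n) : 1 < p -> q = p.+1 :> nat ->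
    (s p = p \/ s p = q) /\ (s q = p \/ s q = q).
  move=> p1 qp; have pn : p < n.-1 by have := ltn_ord q; lia.
  have adjE : adj_tperm (Ordinal pn) = tperm p q.
    by congr tperm; apply: val_inj.
  have fj : far (Ordinal n1) (Ordinal pn) by rewrite /far /= p1.
  have pq : p != q by rewrite -val_eqE /= qp; lia.
  have := u_far _ _ fj; rewrite adjE => /(commute_adj_tperm_stable pq).
  by rewrite !inE => -[/orP[]/eqP-> /orP[]/eqP->]; auto.
(* Such a p is sent into both {p-1, p} and {p, p+1}. *)
have fix_mid (p : 'I_n) : 2 < p -> p.+1 < n -> s p = p.
  move=> p2 pn; have p'n : p.-1 < n by have := ltn_ord p; lia.
  have [_ Hl] := s_adj (Ordinal p'n) p ltac:(rewrite /=; lia)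
    ltac:(rewrite /=; lia).
  have [Hr _] := s_adj p (Ordinal pn) ltac:(lia) erefl.
  by case: Hl Hr => [->|-> //] [/(congr1 val)|/(congr1 val)] /=; lia.
(* The end points 2 and n - 1 lie in only one pair each. Their neighbours 3 and n - 2 are fixed by
   [fix_mid], as n >= 5, and injectivity of s concludes. *)
have fix_high (p : 'I_n) : 1 < p -> s p = p.
  move=> p1; have [p2|p3] := leqP p 2.
    have qn : 3 < n by lia.
    have [[//|spq] _] := s_adj p (Ordinal qn) p1 ltac:(rewrite /=; lia).
    have := fix_mid (Ordinal qn) erefl ltac:(rewrite /=; lia).
    by rewrite -spq => /perm_inj.
  have [/fix_mid -> //|pn] := ltnP p.+1 n.
  have qn : p.-1 < n by have := ltn_ord p; lia.
  have [_ [spq|//]] := s_adj (Ordinal qn) p ltac:(rewrite /=; lia)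
    ltac:(rewrite /=; lia).
  have := fix_mid (Ordinal qn) ltac:(rewrite /=; lia)
    ltac:(have := ltn_ord p; rewrite /=; lia).
  by rewrite -spq => /perm_inj.
have low (p : 'I_n) : p < 2 -> s p < 2.
  move=> p2; rewrite ltnNge; apply/negP => sp.
  by have /perm_inj E := fix_high _ sp; move: sp; rewrite E; lia.
pose a := Ordinal (ltn_ord_pred (Ordinal n1)).
pose b := Ordinal (ltn_ord_predS (Ordinal n1)).
have ab (x : 'I_n) : x < 2 -> x = a \/ x = b.
  case: x => [[|[|x]] xn] //= _; [left|right]; exact: val_inj.
have nab : a != b by [].
pose e := s a == b.
have sb : s b = if e then a else b.
  have [//|E|E] := ab (s b); first exact: low.
    have [//|F|F] := ab (s a); first exact: low.
      by move: nab; rewrite -(inj_eq (@perm_inj _ s)) E F eqxx.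
    by rewrite E /e F eqxx.
  by rewrite /e -[X in _ == X]E (inj_eq perm_inj) (negbTE nab).
have sa : s a = if e then b else a.
  rewrite /e; have [//|E|E] := ab (s a); first exact: low.
    by rewrite E (negbTE nab).
  by rewrite E eqxx.
have sE : s = adj_tperm (Ordinal n1) ^+ e.
  apply/permP => x; have [x2|x2] := ltnP x 2.
    case: (ab x x2) => ->; rewrite ?sa ?sb.
      by case: e {sa sb}; rewrite ?expg1 ?expg0 ?perm1 // tpermL.
    by case: e {sa sb}; rewrite ?expg1 ?expg0 ?perm1 // tpermR.
  rewrite fix_high //; case: e {sa sb}; rewrite ?expg1 ?expg0 ?perm1 //.
  by rewrite tpermD // -val_eqE /=; lia.
exists e => -[k kn]; elim: k kn => [|k IHk] kn.
  by rewrite (bool_irrelevance kn n1).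
apply: (mulIg (adj_tperm (Ordinal (ltnW kn)))).
apply: (mulgI (adj_tperm (Ordinal (ltnW kn)))).
rewrite u_mixed // IHk; case: (e); rewrite ?expg1 ?expg0.
  by rewrite (@adj_tperm_braid _ (Ordinal (ltnW kn)) (Ordinal kn)).
by rewrite !mul1g !adj_tperm2.
Qed.

Lemma vsg_hom_phi n (f : VSG n -> 'S_n) : 4 < n ->
    {morph f : x y / x * y} ->
    (forall i, f (pres_gen _ (Virt i)) = adj_tperm i) ->
  exists2 e, e \in phi_triples & f =1 phi e.
Proof.
move=> n5 fM fv.
have R s t := @vsg_hom_rel _ _ f s t fM.
have [|i j ij|es sE] :=
  @adj_tperm_twist n (fun i => f (pres_gen _ (Sigma i))) n5.
- by move=> i j /vsg_far_sv/R; rewrite !big_cons !big_nil !mulg1 !fv.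
- by have := R _ _ (vsg_vsv ij); rewrite !big_cons !big_nil !mulg1 !fv.
have [|i j ij|et tE] :=
  @adj_tperm_twist n (fun i => f (pres_gen _ (Tau i))) n5.
- by move=> i j /vsg_far_tv/R; rewrite !big_cons !big_nil !mulg1 !fv.
- by have := R _ _ (vsg_vtv ij); rewrite !big_cons !big_nil !mulg1 !fv.
have eE : (nat_of_bool es, nat_of_bool et, 1%N) \in phi_triples.
  (* What is left is sigma trivial and tau not: the relation mixing two sigmas with a tau becomes (0
     1) = (1 2), which fails at the point 0. *)
  case: es et sE tE => -[] // sE tE.
  have i0 : 0 < n.-1 by lia.
  have i1 : 1 < n.-1 by lia.
  have := R _ _ (@vsg_sst _ (Ordinal i0) (Ordinal i1) erefl).
  rewrite !big_cons !big_nil !mulg1 !sE !tE !expg0 !expg1 !mul1g ?mulg1.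
  move/permP/(_ (Ordinal (ltn_ord_pred (Ordinal i0)))).
  by rewrite tpermL tpermD // => /(congr1 val).
exists (nat_of_bool es, nat_of_bool et, 1%N) => //.
apply: vsg_hom_eq => //; first exact: phiM.
by move=> x; rewrite phi_pres_gen //; case: x => i /=; rewrite ?sE ?tE ?fv.
Qed.

(** When the images of the v_i commute, the braid relation makes them all equal, and the mixed
    relations then do the same for the sigma_i and for the tau_i. Only three elements remain, and
    they commute pairwise. *)
Lemma vsg_hom_abelian n (H : groupType) (f : VSG n -> H) : 4 < n ->
    {morph f : x y / x * y} ->
    (forall i j, f (pres_gen _ (Virt i)) * f (pres_gen _ (Virt j)) =
                 f (pres_gen _ (Virt j)) * f (pres_gen _ (Virt i))) ->
  abelian_hom f.
Proof.
move=> n5 fM fv.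
have R s t := @vsg_hom_rel _ _ f s t fM.
pose g x := f (pres_gen _ x).
have i0 : 0 < n.-1 by lia.
pose o := Ordinal i0.
have const (u : 'I_n.-1 -> H) :
    (forall i j : 'I_n.-1, j = i.+1 :> nat -> u j = u i) -> forall i, u i = u o.
  move=> uS [k kn]; elim: k kn => [|k IHk] kn.
    by congr u; apply: val_inj.
  by rewrite (uS (Ordinal (ltnW kn))).
have vE i : g (Virt i) = g (Virt o).
  apply: (const (fun i => g (Virt i))) => {}i j ij.
  have := R _ _ (vsg_vvv ij); rewrite !big_cons !big_nil !mulg1 -!/(g _).
  rewrite (fv i j) => /mulIg E; exact: esym E.
have sE i : g (Sigma i) = g (Sigma o).
  apply: (const (fun i => g (Sigma i))) => {}i j ij.
  have := R _ _ (vsg_vsv ij); rewrite !big_cons !big_nil !mulg1 -!/(g _).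
  by rewrite (vE i) (vE j) => /mulgI/mulIg.
have tE i : g (Tau i) = g (Tau o).
  apply: (const (fun i => g (Tau i))) => {}i j ij.
  have := R _ _ (vsg_vtv ij); rewrite !big_cons !big_nil !mulg1 -!/(g _).
  by rewrite (vE i) (vE j) => /mulgI/mulIg.
(* Indices 0 and 2 are far apart, so the far relations apply to the common values of the
   families. *)
have i2 : 2 < n.-1 by lia.
have o2 : far o (Ordinal i2) by [].
have sv : commute (g (Sigma o)) (g (Virt o)).
  have := R _ _ (vsg_far_sv o2); rewrite !big_cons !big_nil !mulg1 -!/(g _).
  by rewrite vE.
have tv : commute (g (Tau o)) (g (Virt o)).
  have := R _ _ (vsg_far_tv o2); rewrite !big_cons !big_nil !mulg1 -!/(g _).
  by rewrite vE.
have st : commute (g (Sigma o)) (g (Tau o)).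
  by have := R _ _ (vsg_st o); rewrite !big_cons !big_nil !mulg1.
have gC x y : commute (g x) (g y).
  by case: x y => i [] j; rewrite ?vE ?sE ?tE;
    try exact: commute_refl; try exact: commute_sym.
have one := morph_one fM.
have fV := morph_inv fM.
(* Commuting with h passes from generators to the whole group; this is used once for each
   argument. *)
have centr (h : H) : (forall x, commute h (g x)) -> forall y, commute h (f y).
  move=> hC; apply: vsg_ind => [|x y Hy|x y Hy].
  - by rewrite one; apply: commute1.
  - by rewrite fM; apply: commuteM => //; apply: hC.
  by rewrite fM fV; apply: commuteM => //; apply: commuteV; apply: hC.
move=> x y; apply: (centr) => {}y; apply: commute_sym.
by apply: centr => {}x; apply: gC.
Qed.

(** * Classification of the homomorphisms from VSG_n to S_m *)

Theorem theorem23 (n m : nat) (hn : 5 <= n) (hm : 2 <= m) (hmn : m <= n)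
    (psi : {multiplicative (VSG n) -> 'S_m}) :
  abelian_hom psi
  \/ (exists (E : n = m) (e : nat * nat * nat),
        e \in phi_triples /\
        conjugate_homs psi (fun g => cast_perm E (phi e g)))
  \/ (exists (En : n = 6) (Em : 6 = m) (e : nat * nat * nat),
        e \in phi_triples /\
        conjugate_homs psi
          (fun g => cast_perm Em (nu6 (cast_perm En (phi e g))))).
Proof.
have psiM : {morph psi : x y / x * y} by move=> x y; apply: gmulfM.
have R s t := @vsg_hom_rel _ _ psi s t psiM.
have [||| f fM fv] := @coxeter_lift n _ (fun i => psi (pres_gen _ (Virt i))).
- move=> i; have := R [:: Virt i; Virt i] [::] (vsg_vv i).
  by rewrite !big_cons !big_nil !mulg1.
- by move=> i j /vsg_far_vv/R; rewrite !big_cons !big_nil !mulg1.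
- by move=> i j /vsg_vvv/R; rewrite !big_cons !big_nil !mulg1.
have n5 : 4 < #|'I_n| by rewrite card_ord.
have [fC|fI] := sym_hom_abelian_or_inj n5 fM.
  by left; apply: vsg_hom_abelian => // i j; rewrite -!fv fC.
right; have mn : n = m.
  apply/eqP; rewrite eqn_leq hmn andbT leqNgt; apply/negP => lt_mn.
  (* Injectivity gives n! <= m!, which contradicts m < n since n >= 2. *)
  have := leq_card f fI; rewrite !card_Sn leqNgt.
  case: n lt_mn {hn hmn psi psiM R f fM fv n5 fI} => // n; rewrite ltnS => mn.
  case/negP; apply: leq_ltn_trans (leq_fact mn) _.
  by rewrite factS ltn_Pmull ?fact_gt0 //; lia.
subst m.
have [g fK gK] := injF_bij fI.
have gM : {morph g : s t / s * t}.
  by move=> s t; apply: fI; rewrite fM !gK.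
have [||e eE gpsi] := @vsg_hom_phi n (fun x => g (psi x)) hn.
- by move=> x y; rewrite psiM gM.
- by move=> i; rewrite -fv fK.
have psiE x : psi x = f (phi e x) by rewrite -gpsi gK.
have [h [fh|[E fh]]] := sym_aut_inner_or_nu6 hn fM fI; [left|right].
  (* Here psi is h^-1 phi h, so phi is h psi h^-1 and h itself is the conjugator asked for. *)
  exists erefl, e; split=> //; exists h => x.
  by rewrite cast_perm_id psiE fh conjgE !mulgA mulgV mul1g mulgK.
subst n; exists erefl, erefl, e; split=> //; exists h => x.
have := fh (phi e x); rewrite !cast_perm_id psiE => ->.
by rewrite conjgE !mulgA mulgV mul1g mulgK.
Qed.
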